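(* Let $G=(V,E)$ be a connected graph with resistance Laplacian $\mathcal R$ and diagonal matrix of resistance transmissions $\mathcal T=\operatorname{diag}(R\mathbf 1)$. The normalized resistance-cut maximization problem \[ \max_{\substack{A\sqcup B=V\\ A,B\neq\varnothing}}\mathrm{NRC}(A,B) \] has the continuous relaxation \[ \max_{\substack{x\neq\mathbf 0\\ x\perp_{\mathcal T}\mathbf 1}}\frac{x^\top\mathcal R\,x}{x^\top\mathcal T x}, \] where \[ x\perp_{\mathcal T}\mathbf 1\quad\Longleftrightarrow\quad\mathbf 1^\top\mathcal T x=0 . \] The maximum is the largest generalized eigenvalue $\mu_{\max}^{(\mathcal T)}$ of the matrix pair $(\mathcal R,\mathcal T)$. Thus, the maximizers are precisely the generalized eigenvectors satisfying \[ \mathcal R\,x=\mu_{\max}^{(\mathcal T)}\,\mathcal T x . \] Equivalently, \[ \mu_{\max}^{(\mathcal T)}=\lambda_{\max}\!\left(\mathcal R^{\mathrm{sym}}\right),\qquad \mathcal R^{\mathrm{sym}}=\mathcal T^{-1/2}\mathcal R\,\mathcal T^{-1/2}. \]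
   Context: $G$ is a finite, simple, connected, undirected, unweighted graph with vertex set $V=\{1,\dots,n\}$. $L$ is its combinatorial Laplacian (degree matrix minus adjacency matrix), $I$ is the identity matrix of order $n$, $\mathbf 1$ is the all-ones vector, and $L^\dagger$ is the Moore--Penrose inverse of $L$, i.e. the unique symmetric matrix with $LL^\dagger=L^\dagger L=I-\frac1n\mathbf 1\mathbf 1^\top$ and $L^\dagger\mathbf 1=\mathbf 0$. The effective resistance between $i$ and $j$ is $r_{ij}=(L^\dagger)_{ii}+(L^\dagger)_{jj}-2(L^\dagger)_{ij}$, the resistance matrix is $R=(r_{ij})$, and the resistance Laplacian is $\mathcal R=\operatorname{diag}(R\mathbf 1)-R$. The resistance transmission of vertex $i$ is $t_i=\sum_{j=1}^n r_{ij}$, the $i$th diagonal entry of $\mathcal T=\operatorname{diag}(R\mathbf 1)$. For nonempty $C\subseteq V$ its transmission volume is $t(C)=\sum_{i\in C}t_i$. For nonempty disjoint $A,B\subseteq V$ the resistance cut is $\mathrm{ResCut}(A,B)=\sum_{i\in A,\,j\in B}r_{ij}$. For a nontrivial bipartition $A\sqcup B=V$ (disjoint union, both parts nonempty) the normalized resistance cut is $\mathrm{NRC}(A,B)=\mathrm{ResCut}(A,B)\left(\frac1{t(A)}+\frac1{t(B)}\right)$. ''Continuous relaxation'' is used in the usual sense of spectral clustering: the discrete indicator vectors of partitions are replaced by continuous (real-valued) variables. A generalized eigenvalue of the pair $(\mathcal R,\mathcal T)$ is a scalar $\mu$ with $\mathcal R x=\mu\mathcal T x$ for some $x\neq\mathbf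 0$, and such an $x$ is a generalized eigenvector. $\lambda_{\max}$ denotes the largest eigenvalue. *)

(* Defs.v *)
From HB Require Import structures.
From mathcomp Require Import all_boot all_order all_algebra.
From mathcomp Require Import boolp classical_sets reals.

Set Implicit Arguments.
Unset Strict Implicit.
Unset Printing Implicit Defensive.

Import Order.TTheory GRing.Theory Num.Theory.
Local Open Scope ring_scope.

Definition simple_graph n (e : rel 'I_n) : Prop :=
  symmetric e /\ irreflexive e.

Definition connected_graph n (e : rel 'I_n) : Prop :=
  forall i j : 'I_n, connect e i j.

Definition ones (R : realType) n : 'cV[R]_n := const_mx 1.

Definition laplacian (R : realType) n (e : rel 'I_n) : 'M[R]_n :=
  diag_mx (\row_i #|[pred j | e i j]|%:R) - \matrix_(i, j) (e i j)%:R.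

Definition is_laplacian_pinv (R : realType) n (L X : 'M[R]_n) : Prop :=
  let P := 1%:M - n%:R^-1 *: (ones R n *m (ones R n)^T) in
  [/\ X^T = X, L *m X = P, X *m L = P & X *m ones R n = 0].

Lemma laplacian_pinv_unique (R : realType) n (L X Y : 'M[R]_n) :
  is_laplacian_pinv L X -> is_laplacian_pinv L Y -> X = Y.
Proof.
move=> [symX LX _ X1] [_ _ YL Y1].
have X1l : (ones R n)^T *m X = 0 by rewrite -symX -trmx_mul X1 trmx0.
have -> : X = (Y *m L) *m X.
  by rewrite YL mulmxBl mul1mx -scalemxAl -mulmxA X1l mulmx0 scaler0 subr0.
by rewrite -mulmxA LX mulmxBr mulmx1 -scalemxAr mulmxA Y1 mul0mx scaler0 subr0.
Qed.

(* The matrix characterized by is_laplacian_pinv (unique by the lemma above);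
   it exists whenever e is a connected simple graph. *)
Definition laplacian_pinv (R : realType) n (e : rel 'I_n) : 'M[R]_n :=
  xget 0 (is_laplacian_pinv (laplacian R e)).

Definition resistance (R : realType) n (e : rel 'I_n) (i j : 'I_n) : R :=
  let X := laplacian_pinv R e in X i i + X j j - 2 * X i j.

Definition resistance_mx (R : realType) n (e : rel 'I_n) : 'M[R]_n :=
  \matrix_(i, j) resistance R e i j.

Definition transmission (R : realType) n (e : rel 'I_n) (i : 'I_n) : R :=
  \sum_j resistance R e i j.

Definition transmission_mx (R : realType) n (e : rel 'I_n) : 'M[R]_n :=
  diag_mx (resistance_mx R e *m ones R n)^T.

Definition resistance_laplacian (R : realType) n (e : rel 'I_n) : 'M[R]_n :=
  transmission_mx R e - resistance_mx R e.

Definition transmission_inv_sqrt (R : realType) n (e : rel 'I_n) : 'M[R]_n :=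
  diag_mx (\row_i (Num.sqrt (transmission R e i))^-1).

Definition sym_resistance_laplacian (R : realType) n (e : rel 'I_n) : 'M[R]_n :=
  transmission_inv_sqrt R e *m resistance_laplacian R e
    *m transmission_inv_sqrt R e.

Definition volume (R : realType) n (e : rel 'I_n) (C : {set 'I_n}) : R :=
  \sum_(i in C) transmission R e i.

Definition rescut (R : realType) n (e : rel 'I_n) (A B : {set 'I_n}) : R :=
  \sum_(i in A) \sum_(j in B) resistance R e i j.

Definition nrc (R : realType) n (e : rel 'I_n) (A B : {set 'I_n}) : R :=
  rescut R e A B * ((volume R e A)^-1 + (volume R e B)^-1).

Definition nontrivial_bipartition n (A B : {set 'I_n}) : Prop :=
  [/\ A != finset.set0, B != finset.set0, [disjoint A & B]
    & A :|: B = finset.setT].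

Record max_problem (R : realType) (D : Type) := MaxProblem {
  feasible : D -> Prop;
  objective : D -> R
}.

Definition maximizer (R : realType) D (p : max_problem R D) (x : D) : Prop :=
  feasible p x /\ forall y, feasible p y -> objective p y <= objective p x.

Definition is_max_value (R : realType) D (p : max_problem R D) (m : R) : Prop :=
  exists2 x, maximizer p x & objective p x = m.

(* A (real-valued) indicator vector of the bipartition (A, B): one value on A,
   a different one on B. *)
Definition indicates (R : realType) n (AB : {set 'I_n} * {set 'I_n})
    (x : 'cV[R]_n) : Prop :=
  exists a b : R, [/\ a != b, forall i, i \in AB.1 -> x i 0 = a
                    & forall i, i \in AB.2 -> x i 0 = b].

(* q is the continuous relaxation of the bipartition problem p: p amounts to q
   with x further restricted to indicator vectors of p-feasible bipartitions.
   Every p-feasible point has an indicator vector that is q-feasible, and the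
   two objectives agree on all such vectors. *)
Definition continuous_relaxation (R : realType) n
    (p : max_problem R ({set 'I_n} * {set 'I_n}))
    (q : max_problem R 'cV[R]_n) : Prop :=
  (forall AB, feasible p AB -> exists2 x, feasible q x & indicates AB x) /\
  (forall AB x, feasible p AB -> feasible q x -> indicates AB x ->
     objective q x = objective p AB).

Definition nrc_problem (R : realType) n (e : rel 'I_n) :
    max_problem R ({set 'I_n} * {set 'I_n}) :=
  MaxProblem (fun AB => nontrivial_bipartition AB.1 AB.2)
             (fun AB => nrc R e AB.1 AB.2).

Definition quad_form (R : realType) n (M : 'M[R]_n) (x : 'cV[R]_n) : R :=
  (x^T *m M *m x) 0 0.

Definition rayleigh_problem (R : realType) n (e : rel 'I_n) :
    max_problem R 'cV[R]_n :=
  MaxProblem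
    (fun x => x != 0 /\ (ones R n)^T *m transmission_mx R e *m x = 0)
    (fun x => quad_form (resistance_laplacian R e) x
              / quad_form (transmission_mx R e) x).

Definition generalized_eigenvector (R : realType) n (M N : 'M[R]_n) (mu : R)
    (x : 'cV[R]_n) : Prop :=
  x != 0 /\ M *m x = mu *: (N *m x).

Definition generalized_eigenvalue (R : realType) n (M N : 'M[R]_n) (mu : R) :
    Prop :=
  exists x, generalized_eigenvector M N mu x.

Definition is_largest (R : realType) (P : R -> Prop) (m : R) : Prop :=
  P m /\ forall k, P k -> k <= m.

(* Main.v *)
Require Import Defs.
From mathcomp Require Import all_boot all_order all_algebra complex.
From mathcomp Require Import reals.
From mathcomp Require classical_sets.
From mathcomp Require Import ring lra.

Set Implicit Arguments.
Unset Strict Implicit.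
Unset Printing Implicit Defensive.

(** The resistance Laplacian [RL] is the Laplacian of the complete graph whose
    edge weights are the resistances, so [2 x^T RL x] is the sum of
    [r_ij (x_i - x_j)^2]. The weights are positive: [r_ij] is the value of the
    form of [L^+] at [e_i - e_j], and since [L^+ = L^+ L L^+] this form is a
    pullback of the form of [L]; it is nonnegative, and vanishes only on the
    constant vectors because the graph is connected. All of this presupposes
    that the pseudoinverse exists, which holds since [L + J/n] is invertible:
    [(L + J/n)^-1 - J/n] is the pseudoinverse. In particular all transmissions
    are positive ([transmission_gt0]).

    On a vector with value [a] on [A] and [b] on [B], the two forms are
    [(a - b)^2 ResCut(A, B)] and [a^2 t(A) + b^2 t(B)]; orthogonality to the
    constants means [a t(A) + b t(B) = 0], and then the quotient simplifies to
    [NRC(A, B)]. This is [nrc_relaxation].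

    For the maximum, the change of variable [y = T^(1/2) x] turns the pencil
    into the symmetric matrix [T^(-1/2) RL T^(-1/2)]. Its largest eigenvalue
    [mu] satisfies [x^T RL x <= mu x^T T x] for all [x], by the spectral theorem
    ([pencil_top_eigenvalue]). Equality makes [x] an isotropic vector of the
    positive semidefinite matrix [mu T - RL], hence an element of its kernel
    ([pencil_equality]), so equality characterizes the eigenvectors for [mu].
    Finally [mu] is nonzero, as [RL] is nonzero on nonconstant vectors; since
    [RL] kills the constants, eigenvectors for [mu] satisfy the orthogonality
    constraint automatically ([eigenvector_orth_ones]). Hence the constrained
    maximum is [mu] itself. *)

Import Order.TTheory GRing.Theory Num.Theory.
Local Open Scope ring_scope.

(** * Quadratic forms *)

Lemma bipartition_sum (R : realType) n (A B : {set 'I_n}) (F : 'I_n -> R) :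
    A :|: B = [set: 'I_n] -> [disjoint A & B] ->
  \sum_i F i = \sum_(i in A) F i + \sum_(i in B) F i.
Proof.
move=> AB_setT disjAB; rewrite -bigU //=; apply: eq_bigl => i.
by rewrite !inE -in_setU AB_setT inE.
Qed.

Lemma quad_form_sum (R : realType) n (M : 'M[R]_n) (x : 'cV[R]_n) :
  quad_form M x = \sum_i \sum_j M i j * x i 0 * x j 0.
Proof.
rewrite /quad_form mxE exchange_big; apply: eq_bigr => j _ /=.
rewrite mxE mulr_suml; apply: eq_bigr => i _.
by rewrite mxE [x i 0 * _]mulrC.
Qed.

Lemma quad_form_diag (R : realType) n (d : 'rV[R]_n) (x : 'cV[R]_n) :
  quad_form (diag_mx d) x = \sum_i d 0 i * x i 0 ^+ 2.
Proof.
rewrite /quad_form mul_mx_diag mxE; apply: eq_bigr => i _.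
by rewrite !mxE expr2; ring.
Qed.

Lemma quad_formD (R : realType) n (M N : 'M[R]_n) (x : 'cV[R]_n) :
  quad_form (M + N) x = quad_form M x + quad_form N x.
Proof. by rewrite /quad_form mulmxDr mulmxDl [LHS]mxE. Qed.

Lemma quad_formZ (R : realType) n (c : R) (M : 'M[R]_n) (x : 'cV[R]_n) :
  quad_form (c *: M) x = c * quad_form M x.
Proof. by rewrite /quad_form -scalemxAr -scalemxAl [LHS]mxE. Qed.

Lemma quad_formB (R : realType) n (M N : 'M[R]_n) (x : 'cV[R]_n) :
  quad_form (M - N) x = quad_form M x - quad_form N x.
Proof. by rewrite quad_formD -scaleN1r quad_formZ mulN1r. Qed.

Lemma quad_form_congr (R : realType) n (M P : 'M[R]_n) (x : 'cV[R]_n) :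
  quad_form M (P *m x) = quad_form (P^T *m M *m P) x.
Proof. by rewrite /quad_form trmx_mul !mulmxA. Qed.

Lemma quad_form_diag_gt0 (R : realType) n (d : 'rV[R]_n) (x : 'cV[R]_n) :
  (forall i, 0 < d 0 i) -> x != 0 -> 0 < quad_form (diag_mx d) x.
Proof.
move=> d_gt0 x_neq0.
have term_ge0 i : 0 <= d 0 i * x i 0 ^+ 2 by rewrite mulr_ge0 ?sqr_ge0 // ltW.
rewrite quad_form_diag lt_neqAle sumr_ge0 ?andbT //.
apply: contra_neq x_neq0 => /esym/eqP; rewrite psumr_eq0 // => /allP x0.
apply/colP => i; have := x0 i (mem_index_enum _).
by rewrite mxE mulf_eq0 gt_eqF //= sqrf_eq0 => /eqP.
Qed.

Lemma generalized_eigenvector_form (R : realType) n (M N : 'M[R]_n) (a : R)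
    (x : 'cV[R]_n) :
  M *m x = a *: (N *m x) -> quad_form M x = a * quad_form N x.
Proof. by move=> Mx; rewrite /quad_form -!mulmxA Mx -scalemxAr mxE. Qed.

(** A positive semidefinite form that vanishes at [x] is minimal there, so its
    derivative [2 M x] vanishes. *)
Lemma psd_isotropic_ker (R : realType) n (M : 'M[R]_n) (x : 'cV[R]_n) :
    M^T = M -> (forall y, 0 <= quad_form M y) ->
  quad_form M x = 0 -> M *m x = 0.
Proof.
move=> symM M_ge0 Mx0; set y := M *m x.
pose p := quad_form 1%:M y; pose q := quad_form M y.
suff p0 : p = 0.
  apply: contra_eq p0 => y_neq0; rewrite gt_eqF // /p -diag_const_mx.
  by apply: quad_form_diag_gt0 => // i; rewrite mxE.
have p_def : p = (y^T *m y) 0 0 by rewrite /p /quad_form mulmx1.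
have xMy : (x^T *m M *m y) 0 0 = p by rewrite p_def /y trmx_mul symM.
have yMx : (y^T *m M *m x) 0 0 = p by rewrite p_def -mulmxA.
have expand s : quad_form M (x - s *: y) = s ^+ 2 * q - 2 * s * p.
  have trE : (x - s *: y)^T = x^T - s *: y^T by rewrite linearB linearZ.
  rewrite /quad_form trE mulmxBl mulmxBl !mulmxBr.
  rewrite -!scalemxAr -!scalemxAl.
  have entries (U V Z W : 'M[R]_1) :
      (U - s *: V - (s *: Z - s *: (s *: W))) 0 0
      = U 0 0 - s * V 0 0 - (s * Z 0 0 - s * (s * W 0 0)) by rewrite !mxE.
  rewrite entries xMy yMx -/(quad_form M x) Mx0 -/(quad_form M y) -/q.
  by ring.
have q_ge0 : 0 <= q := M_ge0 y.
(* Going downhill along [y = M x] by any small step makes the form negative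
   unless [p = |y|^2] is zero; the step [p / (q + 1)] avoids a division by
   zero when [q = 0]. *)
have := M_ge0 (x - (p / (q + 1)) *: y); rewrite expand.
have -> : (p / (q + 1)) ^+ 2 * q - 2 * (p / (q + 1)) * p
          = - (p ^+ 2 * ((q + 2) / (q + 1) ^+ 2)).
  by field; rewrite gt_eqF //; lra.
have c_gt0 : 0 < (q + 2) / (q + 1) ^+ 2 by rewrite divr_gt0 ?exprn_gt0 //; lra.
rewrite oppr_ge0 pmulr_lle0 // => p2_le0.
by apply/eqP; rewrite -sqrf_eq0 eq_le p2_le0 sqr_ge0.
Qed.

(** * Largest eigenvalue of a symmetric matrix and of a pencil *)

(** Over the complex numbers the symmetric real matrix [A] is Hermitian, so
    [A = P^* diag(d) P] with [P] unitary and [d] real. In the coordinates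
    [y = P x] the inequality reads [sum d_i |y_i|^2 <= mu sum |y_i|^2] with
    [mu] the largest [d_i]; a real number that is an eigenvalue over the
    complex numbers is one over the reals. *)
Lemma symmetric_top_eigenvalue (R : realType) (n : nat) (A : 'M[R]_n) :
    (0 < n)%N -> A^T = A ->
  exists2 mu : R, eigenvalue A mu &
    forall x : 'cV[R]_n, quad_form A x <= mu * quad_form 1%:M x.
Proof.
move=> n_gt0 symA; pose f := real_complex R.
have f_real a : f a \is Num.real by apply/complex_realP; exists a.
have mapC_real m p (M : 'M[R]_(m, p)) :
    map_mx Num.conj (map_mx f M) = map_mx f M.
  by apply: realmxC; apply/mxOverP => i j; rewrite mxE.
pose B := map_mx f A; pose P := spectralmx B; pose d := spectral_diag B.
have unitP : P \in unitmx := unitarymx_unit (spectral_unitarymx _).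
have hermB : B \is hermsymmx.
  apply/is_hermitianmxP; rewrite expr0 scale1r.
  by rewrite /B map_trmx symA mapC_real.
have defB : B = invmx P *m diag_mx d *m P.
  exact/orthomx_spectralP/hermitian_normalmx.
have /mxOverP d_real := hermitian_spectral_diag_real hermB.
have {}d_real i : {l : R | d 0 i = f l}.
  by exists (complex.Re (d 0 i)); apply/esym/RRe_real.
pose l i := sval (d_real i).
have dE i : d 0 i = f (l i) := svalP (d_real i).
have [i0 _ l_max] := @arg_maxP _ R _ (Ordinal n_gt0) xpredT l isT.
exists (l i0).
  suff: eigenvalue B (d 0 i0) by rewrite dE eigenvalue_map.
  apply/eigenvalueP; exists (row i0 P).
    rewrite defB !mulmxA -row_mul mulmxV // -row_mul mul1mx row_diag_mx.
    by rewrite -scalemxAl -rowE.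
  apply/eqP => Pi0; have: row i0 P *m invmx P = 0 by rewrite Pi0 mul0mx.
  rewrite -row_mul mulmxV // => /rowP/(_ i0)/eqP.
  by rewrite !mxE eqxx oner_eq0.
move=> x; pose y := P *m map_mx f x.
have formE M :
    f (quad_form M x) = ((map_mx f x)^T *m map_mx f M *m map_mx f x) 0 0.
  by rewrite /quad_form map_trmx -!map_mxM [RHS]mxE.
have xP : (map_mx f x)^T *m invmx P = map_mx Num.conj y^T.
  rewrite (invmx_unitary (spectral_unitarymx _)) -{1}(mapC_real _ _ x) map_trmx.
  by rewrite -map_mxM -trmx_mul.
have fB : {morph f : a b / a - b} := rmorphB f.
have fM : {morph f : a b / a * b} := rmorphM f.
have f_ge0 a : (0 <= f a) = (0 <= a) := ler0c a.
rewrite -subr_ge0 -f_ge0 fB fM !formE.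
rewrite map_scalar_mx rmorph1 mulmx1 -/B defB.
rewrite !mulmxA xP -[_ *m P *m _]mulmxA -/y.
have -> : (map_mx f x)^T *m map_mx f x = map_mx Num.conj y^T *m y.
  by rewrite -xP /y mulmxA mulmxKV.
rewrite mul_mx_diag !mxE mulr_sumr -sumrB sumr_ge0 // => i _; rewrite !mxE.
rewrite dE mulrAC [_ * f _]mulrC -mulrBl mulr_ge0 //.
  by rewrite -fB f_ge0 subr_ge0; exact: l_max.
by rewrite mulrC mul_conjC_ge0.
Qed.

(** With [t_i] on the diagonal of [T], this is [T^(-1/2)]. *)
Definition diag_inv_sqrt (R : realType) n (t : 'rV[R]_n) : 'M[R]_n :=
  diag_mx (\row_i (Num.sqrt (t 0 i))^-1).

Section Pencil.
Variables (R : realType) (n : nat) (M : 'M[R]_n) (t : 'rV[R]_n).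
Hypotheses (symM : M^T = M) (t_gt0 : forall i, 0 < t 0 i).
Let T := diag_mx t.
Let D := diag_inv_sqrt t.

Lemma diag_inv_sqrtK : D *m (D *m T) = 1%:M.
Proof.
apply/matrixP => i j; rewrite !mul_diag_mx !mxE.
have [_|_] := eqVneq i j; last by rewrite !mulr0n !mulr0.
have s_gt0 : 0 < Num.sqrt (t 0 i) by rewrite sqrtr_gt0.
rewrite !mulr1n mulrA -invfM -expr2 sqr_sqrtr ?ltW // mulVf // gt_eqF //.
Qed.

Lemma diag_inv_sqrtC : D *m T = T *m D.
Proof.
rewrite !mulmx_diag; congr diag_mx.
by apply/rowP => i; rewrite !mxE mulrC.
Qed.

Lemma diag_inv_sqrtVK : T *m D *m D = 1%:M.
Proof. by rewrite -diag_inv_sqrtC mulmx1C // diag_inv_sqrtK. Qed.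

Lemma tr_scaled : (D *m M *m D)^T = D *m M *m D.
Proof. by rewrite !trmx_mul symM tr_diag_mx mulmxA. Qed.

(** [x |-> T^(1/2) x] carries eigenvectors of the pencil to those of the
    scaled matrix. It is written [T *m D], as [D] is [T^(-1/2)]. *)
Lemma pencil_eigenvalue_scaled (a : R) :
  eigenvalue (D *m M *m D) a <-> generalized_eigenvalue M T a.
Proof.
have symS := tr_scaled.
have [DDT TDD] := (diag_inv_sqrtK, diag_inv_sqrtVK).
split=> [/eigenvalueP[v vS v_neq0] | [x [x_neq0 Mx]]].
  exists (D *m v^T); split.
    apply: contra_neq v_neq0 => Dv0; apply: trmx_inj.
    by rewrite -[v^T]mul1mx -TDD -!mulmxA Dv0 !mulmx0 trmx0.
  have Sv : D *m M *m D *m v^T = a *: v^T.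
    by rewrite -{1}symS -trmx_mul vS linearZ.
  rewrite mulmxA -[M *m D]mul1mx -TDD -!mulmxA [D *m (M *m _)]mulmxA.
  by rewrite [D *m M *m _]mulmxA Sv -!scalemxAr.
have xE : D *m (T *m D *m x) = x.
  by rewrite -diag_inv_sqrtC !mulmxA -(mulmxA D D) DDT mul1mx.
apply/eigenvalueP; exists (T *m D *m x)^T.
  rewrite -{1}symS -trmx_mul -linearZ /= -(mulmxA (D *m M)) xE -(mulmxA D) Mx.
  by rewrite -scalemxAr mulmxA diag_inv_sqrtC.
apply: contra_neq x_neq0 => /(congr1 trmx); rewrite trmxK trmx0 => TDx0.
by rewrite -xE TDx0 mulmx0.
Qed.

Lemma pencil_top_eigenvalue : (0 < n)%N ->
  exists2 mu : R, generalized_eigenvalue M T mu &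
    forall x : 'cV[R]_n, quad_form M x <= mu * quad_form T x.
Proof.
move=> n_gt0.
have [mu mu_eig mu_max] := symmetric_top_eigenvalue n_gt0 tr_scaled.
exists mu; first exact/pencil_eigenvalue_scaled.
move=> x; have := mu_max (D *m T *m x).
have [DDT TDD] := (diag_inv_sqrtK, diag_inv_sqrtVK).
rewrite !quad_form_congr mulmx1 trmx_mul !tr_diag_mx -/D -/T.
have -> : T *m D *m (D *m M *m D) *m (D *m T) = M.
  by rewrite !mulmxA TDD mul1mx -mulmxA -mulmxA DDT mulmx1.
by rewrite mulmxA TDD mul1mx.
Qed.

(** [mu T - M] is positive semidefinite and [x] is isotropic for it. *)
Lemma pencil_equality (mu : R) (x : 'cV[R]_n) :
    (forall y, quad_form M y <= mu * quad_form T y) ->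
  quad_form M x = mu * quad_form T x -> M *m x = mu *: (T *m x).
Proof.
move=> mu_max eq_x; apply/esym/eqP; rewrite -subr_eq0 scalemxAl -mulmxBl.
apply/eqP/psd_isotropic_ker => [|y|].
- by rewrite linearB linearZ /= symM tr_diag_mx.
- by rewrite quad_formB quad_formZ subr_ge0.
- by rewrite quad_formB quad_formZ eq_x subrr.
Qed.

End Pencil.

(** * Laplacians of weighted graphs *)

(** Both the combinatorial Laplacian (weights 0 and 1) and the resistance
    Laplacian (weights [r_ij]) are of this form. *)
Definition weighted_laplacian (R : realType) n (W : 'M[R]_n) : 'M[R]_n :=
  diag_mx (\row_i \sum_j W i j) - W.

Section WeightedLaplacian.
Variables (R : realType) (n : nat) (W : 'M[R]_n).
Hypothesis symW : W^T = W.

Lemma tr_weighted_laplacian :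
  (weighted_laplacian W)^T = weighted_laplacian W.
Proof. by rewrite /weighted_laplacian linearB /= tr_diag_mx symW. Qed.

Lemma weighted_laplacian_ones : weighted_laplacian W *m ones R n = 0.
Proof.
apply/colP => i; rewrite mulmxBl mul_diag_mx !mxE mulr1.
by apply/eqP; rewrite subr_eq0; apply/eqP/eq_bigr => j _; rewrite mxE mulr1.
Qed.

Lemma weighted_laplacian_form (x : 'cV[R]_n) :
  2 * quad_form (weighted_laplacian W) x
  = \sum_i \sum_j W i j * (x i 0 - x j 0) ^+ 2.
Proof.
rewrite quad_formB quad_form_diag quad_form_sum.
pose S := \sum_i \sum_j W i j * x i 0 ^+ 2.
have S1 : \sum_i (\row_i \sum_j W i j) 0 i * x i 0 ^+ 2 = S.
  by apply: eq_bigr => i _; rewrite mxE mulr_suml.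
have S2 : \sum_i \sum_j W i j * x j 0 ^+ 2 = S.
  rewrite exchange_big; apply: eq_bigr => i _; apply: eq_bigr => j _.
  by rewrite -symW mxE symW.
rewrite S1 mulrBr [2 * S]mulr_natl mulr2n -{2}S2 mulr_sumr /S -big_split -sumrB /=.
apply: eq_bigr => i _; rewrite mulr_sumr -big_split -sumrB /=.
by apply: eq_bigr => j _; ring.
Qed.

Lemma weighted_laplacian_form_ge0 (x : 'cV[R]_n) :
  (forall i j, 0 <= W i j) -> 0 <= quad_form (weighted_laplacian W) x.
Proof.
move=> W_ge0; rewrite -(pmulr_rge0 _ (ltr0n R 2)) weighted_laplacian_form.
by apply: sumr_ge0 => i _; apply: sumr_ge0 => j _; rewrite mulr_ge0 ?sqr_ge0.
Qed.

Lemma weighted_laplacian_form_eq0 (x : 'cV[R]_n) i j :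
    (forall i j, 0 <= W i j) -> quad_form (weighted_laplacian W) x = 0 ->
  0 < W i j -> x i 0 = x j 0.
Proof.
move=> W_ge0 /(congr1 ( *%R 2)); rewrite mulr0 weighted_laplacian_form.
have term_ge0 k l : 0 <= W k l * (x k 0 - x l 0) ^+ 2.
  by rewrite mulr_ge0 ?sqr_ge0.
move=> /eqP; rewrite psumr_eq0 => [/allP/(_ i (mem_index_enum _))|k _]; last first.
  exact: sumr_ge0.
rewrite /= psumr_eq0 // => /allP/(_ j (mem_index_enum _)) /=.
rewrite mulf_eq0 => /orP[/eqP->|]; first by rewrite ltxx.
by rewrite sqrf_eq0 subr_eq0 => /eqP.
Qed.

Lemma weighted_laplacian_cut (A B : {set 'I_n}) (x : 'cV[R]_n) (a b : R) :
    A :|: B = [set: 'I_n] -> [disjoint A & B] ->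
    (forall i, i \in A -> x i 0 = a) -> (forall i, i \in B -> x i 0 = b) ->
  quad_form (weighted_laplacian W) x
  = (a - b) ^+ 2 * \sum_(i in A) \sum_(j in B) W i j.
Proof.
move=> AB_setT disjAB xA xB.
apply: (mulfI (_ : 2 != 0 :> R)); first by rewrite pnatr_eq0.
have swap :
    \sum_(i in B) \sum_(j in A) W i j = \sum_(i in A) \sum_(j in B) W i j.
  rewrite exchange_big; apply: eq_bigr => i _; apply: eq_bigr => j _.
  by rewrite -{1}symW mxE.
have block (C C' : {set 'I_n}) c c' :
    (forall i, i \in C -> x i 0 = c) -> (forall i, i \in C' -> x i 0 = c') ->
    \sum_(i in C) \sum_(j in C') W i j * (x i 0 - x j 0) ^+ 2
    = (c - c') ^+ 2 * \sum_(i in C) \sum_(j in C') W i j.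
  move=> xC xC'; rewrite mulr_sumr; apply: eq_bigr => i iC.
  by rewrite mulr_sumr; apply: eq_bigr => j jC; rewrite xC // xC' // mulrC.
rewrite weighted_laplacian_form (bipartition_sum _ AB_setT disjAB).
under eq_bigr do rewrite (bipartition_sum _ AB_setT disjAB).
under [X in _ + X]eq_bigr do rewrite (bipartition_sum _ AB_setT disjAB).
rewrite !big_split /= (block _ _ _ _ xA xA) (block _ _ _ _ xA xB).
by rewrite (block _ _ _ _ xB xA) (block _ _ _ _ xB xB) swap; ring.
Qed.

End WeightedLaplacian.

(** * Effective resistances are positive *)

Section Graph.
Variables (R : realType) (n : nat) (e : rel 'I_n).
Hypotheses (n_gt1 : (1 < n)%N) (he : simple_graph e) (hc : connected_graph e).

Let n_gt0 : (0 < n)%N := ltnW n_gt1.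
Let n_neq0 : n%:R != 0 :> R.
Proof. by rewrite pnatr_eq0 -lt0n. Qed.

Let adjacency : 'M[R]_n := \matrix_(i, j) (e i j)%:R.
Let L := laplacian R e.
Let one := ones R n.
Let X := laplacian_pinv R e.
Let T := transmission_mx R e.
Let RL := resistance_laplacian R e.

Lemma tr_adjacency : adjacency^T = adjacency.
Proof. by apply/matrixP => i j; rewrite !mxE; case: he => ->. Qed.

Lemma laplacianE : L = weighted_laplacian adjacency.
Proof.
rewrite /L /laplacian /weighted_laplacian; congr (diag_mx _ - _).
apply/rowP => i; rewrite !mxE -sum1_card natr_sum big_mkcond /=.
by apply: eq_bigr => j _; rewrite mxE inE; case: (e i j).
Qed.

Lemma adjacency_ge0 i j : 0 <= adjacency i j.
Proof. by rewrite mxE ler0n. Qed.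

Lemma laplacian_form_ge0 x : 0 <= quad_form L x.
Proof.
rewrite laplacianE; apply: weighted_laplacian_form_ge0 => [|i j].
  exact: tr_adjacency.
exact: adjacency_ge0.
Qed.

Lemma laplacian_ones : L *m one = 0.
Proof. by rewrite laplacianE weighted_laplacian_ones. Qed.

(** The form is a sum over edges of [(x_i - x_j)^2], so [x] is constant along
    each edge, hence along each path. *)
Lemma laplacian_form_eq0 x :
  quad_form L x = 0 -> forall i j, x i 0 = x j 0.
Proof.
rewrite laplacianE => Lx0 i j; have /connectP[p] := hc i j.
elim: p i => [|k p IHp] i /=; first by move=> _ ->.
move=> /andP[eik pathp] lastp; rewrite -(IHp k) //.
apply: (weighted_laplacian_form_eq0 tr_adjacency _ Lx0) => [? ?|].
  exact: adjacency_ge0.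
by rewrite mxE eik ltr01.
Qed.

Let J := one *m one^T.
Let P := 1%:M - n%:R^-1 *: J.

Lemma ones_form : one^T *m one = n%:R%:M.
Proof.
apply/matrixP => i j; rewrite !ord1 !mxE eqxx mulr1n.
rewrite (eq_bigr (fun=> 1)) => [|k _]; last by rewrite !mxE mulr1.
by rewrite sumr_const card_ord.
Qed.

Lemma form_ones x : quad_form J x = (one^T *m x) 0 0 ^+ 2.
Proof.
rewrite /quad_form /J -!mulmxA mulmxA -[x^T *m one]trmxK trmx_mul trmxK.
by rewrite mxE big_ord1 mxE expr2.
Qed.

(** [L] and [J/n] are both positive semidefinite; a vector isotropic for both
    is constant by connectedness and has sum zero, so it is zero. *)
Lemma laplacian_shift_unit : L + n%:R^-1 *: J \in unitmx.
Proof.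
rewrite -row_free_unit; apply: inj_row_free => v vK0.
have Jv_ge0 : 0 <= n%:R^-1 * quad_form J v^T.
  by rewrite mulr_ge0 ?invr_ge0 ?ler0n // form_ones sqr_ge0.
have Lv_ge0 := laplacian_form_ge0 v^T.
have formK : quad_form L v^T + n%:R^-1 * quad_form J v^T = 0.
  rewrite -quad_formZ -quad_formD.
  by rewrite /quad_form trmxK vK0 mul0mx mxE.
have Lv0 : quad_form L v^T = 0 by lra.
have Jv0 : n%:R^-1 * quad_form J v^T = 0 by lra.
move/eqP: Jv0; rewrite mulf_eq0 invr_eq0 (negPf n_neq0) /= form_ones sqrf_eq0.
rewrite mxE => /eqP sum_v; apply/rowP => i; rewrite mxE.
apply: (mulfI n_neq0); rewrite mulr0 -[RHS]sum_v mulr_natl.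
rewrite (eq_bigr (fun=> v 0 i)) ?sumr_const ?card_ord // => j _.
by rewrite 2!mxE mul1r (laplacian_form_eq0 Lv0 j i) mxE.
Qed.

Lemma tr_laplacian : L^T = L.
Proof. by rewrite laplacianE tr_weighted_laplacian // tr_adjacency. Qed.

(** [K = L + J/n] acts as [L] on the vectors of sum zero and fixes the
    constants, so [K^-1 - J/n] inverts [L] on the former and kills the
    latter. *)
Lemma laplacian_pinv_spec : is_laplacian_pinv L X.
Proof.
pose K := L + n%:R^-1 *: J; have uK : K \in unitmx := laplacian_shift_unit.
have symJ : J^T = J by rewrite /J trmx_mul trmxK.
have symK : K^T = K by rewrite linearD linearZ /= symJ tr_laplacian.
have K1 : K *m one = one.
  rewrite mulmxDl laplacian_ones add0r -scalemxAl -mulmxA ones_form.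
  by rewrite mul_mx_scalar scalerA mulVf // scale1r.
have V1 : invmx K *m one = one by rewrite -{1}K1 mulKmx.
have symV : (invmx K)^T = invmx K by rewrite trmx_inv symK.
have V1l : one^T *m invmx K = one^T by rewrite -symV -trmx_mul V1.
have LJ : L *m J = 0 by rewrite mulmxA laplacian_ones mul0mx.
have JL : J *m L = 0 by rewrite -symJ -tr_laplacian -trmx_mul LJ trmx0.
have LE : L = K - n%:R^-1 *: J by rewrite addrK.
apply: (@classical_sets.xgetI _ 0 _ (invmx K - n%:R^-1 *: J)); split.
- by rewrite linearB linearZ /= symV symJ.
- rewrite mulmxBr -scalemxAr LJ scaler0 subr0 -/L {1}LE mulmxBl mulmxV //.
  by rewrite -scalemxAl -mulmxA V1l.
- rewrite mulmxBl -scalemxAl JL scaler0 subr0 -/L {1}LE mulmxBr mulVmx //.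
  by rewrite -scalemxAr mulmxA V1.
- rewrite mulmxBl V1 -scalemxAl -mulmxA ones_form mul_mx_scalar scalerA.
  by rewrite mulVf // scale1r subrr.
Qed.

Lemma tr_laplacian_pinv : X^T = X.
Proof. by case: laplacian_pinv_spec. Qed.

Lemma resistance_sym i j : resistance R e i j = resistance R e j i.
Proof.
rewrite /resistance -/X -[X j i]/(X j i) -{3}tr_laplacian_pinv mxE.
by rewrite [X i i + _]addrC.
Qed.

Lemma resistance_form i j :
  resistance R e i j = quad_form X (delta_mx i 0 - delta_mx j 0).
Proof.
have entry (M : 'M[R]_n) k l :
    ((delta_mx 0 k : 'rV_n) *m M *m (delta_mx l 0 : 'cV_n)) 0 0 = M k l.
  by rewrite -rowE -colE !mxE.
rewrite /quad_form [(_ - _)^T]linearB /= !trmx_delta mulmxBl mulmxBl !mulmxBr.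
have sub4 (U V Z W : 'M[R]_1) :
  (U - V - (Z - W)) 0 0 = U 0 0 - V 0 0 - (Z 0 0 - W 0 0) by rewrite !mxE.
rewrite sub4 !entry /resistance -/X -[X j i]/(X j i).
have -> : X j i = X i j by rewrite -{1}tr_laplacian_pinv mxE.
by ring.
Qed.

Lemma resistance_diag i : resistance R e i i = 0.
Proof. by rewrite /resistance -/X; ring. Qed.

(** [X = X L X] rewrites the form of [X] at [u = e_i - e_j] as the form of [L]
    at [X u]. If it vanished then [L X u = 0]; but [L X] is the projection
    onto the vectors of sum zero, which fixes [u]. *)
Lemma resistance_gt0 i j : i != j -> 0 < resistance R e i j.
Proof.
move=> neq_ij; set u : 'cV[R]_n := delta_mx i 0 - delta_mx j 0.
have [symX LX XL X1] := laplacian_pinv_spec.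
have XLX : X *m L *m X = X.
  rewrite XL mulmxBl mul1mx -scalemxAl -mulmxA -[one^T *m X]trmxK trmx_mul.
  by rewrite symX trmxK X1 trmx0 mulmx0 scaler0 subr0.
have formX : quad_form X u = quad_form L (X *m u).
  by rewrite quad_form_congr symX XLX.
rewrite resistance_form -/u formX lt_neqAle laplacian_form_ge0 andbT.
apply/negP => /eqP/esym form0.
have LXu : L *m (X *m u) = 0.
  apply: psd_isotropic_ker form0 => [|y]; first exact: tr_laplacian.
  exact: laplacian_form_ge0.
have u1 : one^T *m u = 0.
  have one_delta k : one^T *m (delta_mx k 0 : 'cV[R]_n) = 1%:M.
    by rewrite -colE; apply/matrixP => a b; rewrite !mxE !ord1.
  by rewrite mulmxBr !one_delta subrr.
move: LXu; rewrite mulmxA LX mulmxBl mul1mx -scalemxAl -mulmxA u1 mulmx0.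
rewrite scaler0 subr0 => /colP/(_ i)/eqP.
by rewrite !mxE eqxx (negPf neq_ij) subr0 oner_eq0.
Qed.

Lemma resistance_ge0 i j : 0 <= resistance R e i j.
Proof.
have [->|neq_ij] := eqVneq i j; first by rewrite resistance_diag.
exact/ltW/resistance_gt0.
Qed.

Lemma transmission_gt0 i : 0 < transmission R e i.
Proof.
have [j neq_ij] : exists j : 'I_n, i != j.
  have [i0|] := eqVneq (i : nat) 0.
    by exists (Ordinal n_gt1); rewrite -val_eqE /= i0.
  by exists (Ordinal n_gt0); rewrite -val_eqE.
rewrite /transmission (bigD1 j) //= ltr_pwDl ?resistance_gt0 //.
by apply: sumr_ge0 => k _; exact: resistance_ge0.
Qed.

Lemma transmission_mxE : T = diag_mx (\row_i transmission R e i).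
Proof.
congr diag_mx; apply/rowP => i; rewrite !mxE.
by apply: eq_bigr => j _; rewrite !mxE mulr1.
Qed.

Lemma tr_resistance_mx : (resistance_mx R e)^T = resistance_mx R e.
Proof. by apply/matrixP => i j; rewrite !mxE resistance_sym. Qed.

Lemma resistance_laplacianE : RL = weighted_laplacian (resistance_mx R e).
Proof.
rewrite /RL /resistance_laplacian -/T transmission_mxE; congr (diag_mx _ - _).
by apply/rowP => i; rewrite !mxE; apply: eq_bigr => j _; rewrite mxE.
Qed.

Lemma volume_gt0 (C : {set 'I_n}) : C != finset.set0 -> 0 < volume R e C.
Proof.
case/set0Pn => i iC.
rewrite /volume (bigD1 i) //= ltr_pwDl ?transmission_gt0 //.
by apply: sumr_ge0 => j _; exact/ltW/transmission_gt0.
Qed.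

End Graph.

(** * The relaxation and its maximum *)

Section Relaxation.
Variables (R : realType) (n : nat) (e : rel 'I_n).
Hypotheses (n_gt1 : (1 < n)%N) (he : simple_graph e) (hc : connected_graph e).

Let T := transmission_mx R e.
Let RL := resistance_laplacian R e.

Lemma ones_transmission (x : 'cV[R]_n) :
  ((ones R n)^T *m T *m x) 0 0 = \sum_i transmission R e i * x i 0.
Proof.
rewrite /T transmission_mxE mul_mx_diag mxE; apply: eq_bigr => i _.
by rewrite !mxE mul1r.
Qed.

(** The constraint [a t(A) + b t(B) = 0] determines [b] from [a], after which
    the quotient of the two forms is a rational identity in [a], [t(A)] and
    [t(B)], in which [a] cancels. *)
Lemma nrc_relaxation :
  continuous_relaxation (nrc_problem R e) (rayleigh_problem R e).
Proof.
split=> [[A B] | [A B] x]; case=> /= A_neq0 B_neq0 disjAB AB_setT.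
  have tA := volume_gt0 R n_gt1 he hc A_neq0.
  have tB := volume_gt0 R n_gt1 he hc B_neq0.
  (* Up to scaling, the only indicator vector with weighted sum zero. *)
  pose x : 'cV[R]_n :=
    \col_i if i \in A then (volume R e A)^-1 else - (volume R e B)^-1.
  have xA i : i \in A -> x i 0 = (volume R e A)^-1 by rewrite mxE => ->.
  have xB i : i \in B -> x i 0 = - (volume R e B)^-1.
    by rewrite mxE => /(disjointFl disjAB) ->.
  have vA : 0 < (volume R e A)^-1 by rewrite invr_gt0.
  have vB : 0 < (volume R e B)^-1 by rewrite invr_gt0.
  exists x; last first.
    exists (volume R e A)^-1, (- (volume R e B)^-1); split=> //.
    by rewrite gt_eqF //; lra.
  split.
    have [i iA] := set0Pn _ A_neq0.
    by apply: contraTneq vA => x0; rewrite -(xA i iA) x0 mxE ltxx.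
  apply/matrixP => i j; rewrite !ord1 ones_transmission mxE.
  rewrite (bipartition_sum _ AB_setT disjAB).
  under eq_bigr => k kA do rewrite xA //.
  under [X in _ + X]eq_bigr => k kB do rewrite xB //.
  rewrite -!mulr_suml -!/(volume R e _) mulrN !mulfV ?gt_eqF //.
  by rewrite subrr.
move=> [x_neq0 x_orth] [a [b [neq_ab xA xB]]].
have tA := volume_gt0 R n_gt1 he hc A_neq0.
have tB := volume_gt0 R n_gt1 he hc B_neq0.
have balance : volume R e A * a + volume R e B * b = 0.
  transitivity (((ones R n)^T *m T *m x) 0 0); last by rewrite x_orth mxE.
  rewrite ones_transmission (bipartition_sum _ AB_setT disjAB).
  rewrite /volume !mulr_suml.
  by congr (_ + _); apply: eq_bigr => i iC; by [rewrite xA | rewrite xB].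
have formT : quad_form T x = volume R e A * a ^+ 2 + volume R e B * b ^+ 2.
  rewrite /T transmission_mxE quad_form_diag (bipartition_sum _ AB_setT disjAB).
  rewrite /volume !mulr_suml.
  by congr (_ + _); apply: eq_bigr => i iC;
    by [rewrite mxE xA | rewrite mxE xB].
have formR : quad_form RL x = (a - b) ^+ 2 * rescut R e A B.
  rewrite /RL resistance_laplacianE.
  rewrite (weighted_laplacian_cut _ AB_setT disjAB xA xB) ?tr_resistance_mx //.
  congr (_ * _); apply: eq_bigr => i _; apply: eq_bigr => j _.
  by rewrite mxE.
rewrite -/T -/RL formT formR /nrc.
move: tA tB balance; set p := volume R e A.
set q := volume R e B => p_gt0 q_gt0 balance.
have bE : b = - (p * a / q).
  apply: (mulfI (lt0r_neq0 q_gt0)).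
  by rewrite mulrN mulrCA mulfV ?lt0r_neq0 // mulr1; lra.
have a_neq0 : a != 0.
  by apply: contra_neq neq_ab => a0; rewrite bE a0 mulr0 mul0r oppr0.
have a2_gt0 : 0 < a ^+ 2 by rewrite exprn_even_gt0.
rewrite bE; field; rewrite !lt0r_neq0 //= sqrrN exprMn.
apply: addr_gt0; first exact: mulr_gt0 (mulr_gt0 p_gt0 a2_gt0) q_gt0.
exact: mulr_gt0 (exprn_gt0 2 p_gt0) a2_gt0.
Qed.

(** [1^T RL = 0], so [mu 1^T T x = 1^T RL x = 0]. *)
Lemma eigenvector_orth_ones (mu : R) (x : 'cV[R]_n) :
    mu != 0 -> RL *m x = mu *: (T *m x) ->
  (ones R n)^T *m T *m x = 0.
Proof.
move=> mu_neq0 RLx; have symW := tr_resistance_mx R n_gt1 he hc.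
have one_RL : (ones R n)^T *m RL = 0.
  rewrite /RL resistance_laplacianE.
  rewrite -[weighted_laplacian _]tr_weighted_laplacian //.
  by rewrite -trmx_mul weighted_laplacian_ones trmx0.
apply: (scalerI mu_neq0); rewrite scaler0 -mulmxA scalemxAr -RLx mulmxA one_RL.
by rewrite mul0mx.
Qed.

End Relaxation.

Theorem theorem3p7 (R : realType) (n : nat) (e : rel 'I_n)
    (hn : (1 < n)%N) (he : simple_graph e) (hc : connected_graph e) :
  continuous_relaxation (nrc_problem R e) (rayleigh_problem R e) /\
  exists mu : R,
    [/\ is_largest
          (generalized_eigenvalue (resistance_laplacian R e)
                                  (transmission_mx R e)) mu,
        is_max_value (rayleigh_problem R e) mu,
        forall x : 'cV[R]_n,
          maximizer (rayleigh_problem R e) x <->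
          generalized_eigenvector (resistance_laplacian R e)
                                  (transmission_mx R e) mu x
      & is_largest
          (fun a : R => eigenvalue (sym_resistance_laplacian R e) a) mu].
Proof.
split; first exact: nrc_relaxation.
set M := resistance_laplacian R e; set T := transmission_mx R e.
pose t : 'rV[R]_n := \row_i transmission R e i.
have TE : T = diag_mx t := transmission_mxE R e.
have t_gt0 i : 0 < t 0 i by rewrite mxE transmission_gt0.
have symW := tr_resistance_mx R hn he hc.
have symM : M^T = M by rewrite /M resistance_laplacianE tr_weighted_laplacian.
have [mu mu_eig mu_max] := pencil_top_eigenvalue symM t_gt0 (ltnW hn).
rewrite -TE in mu_eig; have {}mu_max x : quad_form M x <= mu * quad_form T x.
  by rewrite TE.
have T_gt0 x : x != 0 -> 0 < quad_form T x.
  by rewrite TE; exact: quad_form_diag_gt0.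
have mu_largest : is_largest (generalized_eigenvalue M T) mu.
  split=> // k [x [x_neq0 Mx]]; rewrite -(ler_pM2r (T_gt0 x x_neq0)).
  by rewrite -(generalized_eigenvector_form Mx).
(* If [mu] were zero, the form of [M] would be nonpositive, hence zero, at the
   indicator vector of a single vertex, which is not constant as [1 < n]. *)
have mu_neq0 : mu != 0.
  pose i0 := Ordinal (ltnW hn); pose i1 := Ordinal hn.
  have x_neq :
      (delta_mx i0 0 : 'cV[R]_n) i0 0 != (delta_mx i0 0 : 'cV[R]_n) i1 0.
    by rewrite !mxE !eqxx /= oner_eq0.
  apply: contra_neq x_neq => mu0.
  apply: (weighted_laplacian_form_eq0 symW) => [i j||].
  - by rewrite mxE resistance_ge0.
  - apply/eqP; rewrite eq_le weighted_laplacian_form_ge0 // ?andbT.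
      by rewrite -resistance_laplacianE (le_trans (mu_max _)) // mu0 mul0r.
    by move=> i j; rewrite mxE resistance_ge0.
  - by rewrite mxE resistance_gt0.
have eigen_feasible x : generalized_eigenvector M T mu x ->
    feasible (rayleigh_problem R e) x
    /\ objective (rayleigh_problem R e) x = mu.
  case=> x_neq0 Mx; split=> /=.
    by split=> //; exact: eigenvector_orth_ones mu_neq0 Mx.
  by rewrite (generalized_eigenvector_form Mx) mulfK // gt_eqF // T_gt0.
have le_mu x : x != 0 -> objective (rayleigh_problem R e) x <= mu.
  by move=> x_neq0; rewrite /= ler_pdivrMr ?T_gt0.
have eigen_max x : generalized_eigenvector M T mu x ->
    maximizer (rayleigh_problem R e) x.
  move=> /eigen_feasible[feas_x obj_x]; split=> // y [y_neq0 _].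
  by rewrite obj_x le_mu.
exists mu; split=> //.
- have [x eig_x] := mu_eig; exists x; first exact: eigen_max.
  by case: (eigen_feasible x eig_x).
- move=> x; split=> [[[x_neq0 x_orth] x_max]|]; last exact: eigen_max.
  split=> //; have [z eig_z] := mu_eig.
  have [feas_z obj_z] := eigen_feasible z eig_z.
  have mu_le : mu * quad_form T x <= quad_form M x.
    by rewrite -ler_pdivlMr ?T_gt0 // -obj_z x_max.
  rewrite TE; apply: (pencil_equality symM) => [y|]; rewrite -TE //.
  by apply: le_anti; rewrite mu_max.
- have SE : sym_resistance_laplacian R e
      = diag_inv_sqrt t *m M *m diag_inv_sqrt t.
    rewrite /sym_resistance_laplacian; congr (_ *m _ *m _);
      by congr diag_mx; apply/rowP => i; rewrite !mxE.
  have eigE k : eigenvalue (sym_resistance_laplacian R e) k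
                <-> generalized_eigenvalue M T k.
    by rewrite SE TE; exact: pencil_eigenvalue_scaled.
  by split=> [|k /eigE]; [exact/eigE | case: mu_largest => _; exact].
Qed.
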